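(* For all integers $m\ge0$, $$P_{3m}(X)=X^mP_m(X),$$ $$P_{3m+1}(X)=\tfrac13X^m\bigl((1+X)P_m(X)+P_{m+1}(X)\bigr),$$ $$P_{3m+2}(X)=\tfrac13X^m\bigl(XP_m(X)+(1+X)P_{m+1}(X)\bigr).$$
   Context: Let $\Gamma=\mathbb Z_3=\{x=(x_0,x_1,\dots):x_k\in\{0,1,2\}\}$ be the compact group of 3-adic integers, $\lambda$ its Haar probability measure (coordinates i.i.d. uniform on $\{0,1,2\}$), and $Sx=x+1$. Let $\phi(x)\in\{0,1\}$ be the first coordinate of $x$ different from $2$ (defined for $x\neq(2,2,\dots)$). Set $\phi^{(0)}=0$ and $\phi^{(m)}(x)=\phi(x)+\phi(Sx)+\cdots+\phi(S^{m-1}x)$ for $m\ge1$ (defined $\lambda$-a.e.). Let $\pi_m(j)=\lambda(\phi^{(m)}=j)$ for $j\in\mathbb Z$ and $P_m(X)=\mathbb E_\lambda[X^{\phi^{(m)}}]=\sum_{j=0}^m\pi_m(j)X^j$. *)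

(* Defs.v *)
From HB Require Import structures.
From mathcomp Require Import all_boot all_order all_algebra.
From mathcomp Require Import all_classical all_reals all_analysis.
From mathcomp Require Import zify lra.

Set Implicit Arguments.
Unset Strict Implicit.
Unset Printing Implicit Defensive.

Import Order.TTheory GRing.Theory Num.Theory.
Import numFieldNormedType.Exports.

Local Open Scope classical_set_scope.
Local Open Scope ring_scope.

Definition Z3 : Type := prod_topology (fun _ : nat => discrete_topology 'I_3).

HB.instance Definition _ := Choice.on Z3.
HB.instance Definition _ := isPointed.Build Z3 (fun=> ord0 : 'I_3).
HB.instance Definition _ := Nbhs.on Z3.
HB.instance Definition _ := Topological.on Z3.
HB.instance Definition _ := Measurable.copy Z3 (g_sigma_algebraType (@open Z3)).

Definition digit (x : Z3) (k : nat) : 'I_3 := x k.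

Fixpoint carry (x y : Z3) (k : nat) : nat :=
  if k is k'.+1 then ((digit x k' + digit y k' + carry x y k') %/ 3)%N else 0%N.

Definition addZ3 (x y : Z3) : Z3 :=
  fun k => inZp (digit x k + digit y k + carry x y k) : 'I_3.
Definition zeroZ3 : Z3 := fun=> ord0 : 'I_3.
Definition oneZ3 : Z3 := fun k => inZp (k == 0%N) : 'I_3.
(* [2 - x_k] in every digit is [-1 - x]. *)
Definition oppZ3 (x : Z3) : Z3 := addZ3 (fun k => rev_ord (digit x k)) oneZ3.

(* The residue of x modulo 3 ^ n. *)
Definition residue (n : nat) (x : Z3) : nat := (\sum_(k < n) digit x k * 3 ^ k)%N.

Lemma residueS n x : residue n.+1 x = (residue n x + digit x n * 3 ^ n)%N.
Proof. by rewrite /residue big_ord_recr. Qed.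

Lemma residue_lt n x : (residue n x < 3 ^ n)%N.
Proof.
elim: n => [|n IH]; first by rewrite /residue big_ord0.
by rewrite residueS expnS; have := ltn_ord (digit x n); nia.
Qed.

Lemma residueP n x y :
  residue n x = residue n y <-> (forall k, (k < n)%N -> digit x k = digit y k).
Proof.
split; last first.
  by move=> xy; apply: eq_bigr => k _; rewrite xy.
elim: n => // n IH; rewrite !residueS => e.
have e1 : residue n x = residue n y.
  have := congr1 (modn^~ (3 ^ n)%N) e.
  by rewrite /= ![(residue _ _ + _)%N]addnC !modnMDl !modn_small ?residue_lt.
move=> k; rewrite ltnS leq_eqVlt => /predU1P[->|]; last exact: IH.
move: e; rewrite e1 => /addnI/eqP; rewrite eqn_pmul2r ?expn_gt0//.
by move=> /eqP/val_inj.
Qed.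

Lemma residue_inj x y : (forall n, residue n x = residue n y) -> x = y.
Proof.
by move=> xy; apply/funext => k; apply: ((residueP k.+1 x y).1 (xy _)).
Qed.

Lemma residue_addE n x y :
  (residue n (addZ3 x y) + carry x y n * 3 ^ n = residue n x + residue n y)%N.
Proof.
elim: n => [|n IH]; first by rewrite /residue !big_ord0.
rewrite !residueS /= {2}/digit /addZ3 /=.
set t := (digit x n + digit y n + carry x y n)%N.
rewrite expnS mulnA -addnA -mulnDl [(t %% 3 + _)%N]addnC -divn_eq /t !mulnDl.
move: (residue n _) (residue n x) (residue n y) IH => a b c.
by lia.
Qed.

Lemma residue_add n x y :
  residue n (addZ3 x y) = ((residue n x + residue n y) %% 3 ^ n)%N.
Proof. by rewrite -residue_addE addnC modnMDl modn_small ?residue_lt. Qed.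

Lemma residue0 n : residue n zeroZ3 = 0%N.
Proof. by rewrite /residue big1. Qed.

Lemma residue1 n : residue n oneZ3 = (1 %% 3 ^ n)%N.
Proof.
elim: n => [|n IH]; first by rewrite /residue big_ord0.
rewrite residueS IH /digit /oneZ3 /=; case: n {IH} => // n.
by rewrite mul0n addn0 !modn_small// -[1%N](expn0 3) ltn_exp2l.
Qed.

Fact addZ3A : associative addZ3.
Proof.
by move=> x y z; apply: residue_inj => n; rewrite !residue_add modnDml modnDmr addnA.
Qed.

Fact addZ3C : commutative addZ3.
Proof. by move=> x y; apply: residue_inj => n; rewrite !residue_add addnC. Qed.

Fact add0Z3 : left_id zeroZ3 addZ3.
Proof.
move=> x; apply: residue_inj => n.
by rewrite residue_add residue0 add0n modn_small ?residue_lt.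
Qed.

Fact addNZ3 : left_inverse zeroZ3 oppZ3 addZ3.
Proof.
move=> x; apply: residue_inj => n; rewrite !residue_add residue0 residue1.
rewrite modnDml addnAC modnDmr.
suff -> : (residue n (fun k => rev_ord (digit x k)) + residue n x + 1 = 3 ^ n)%N.
  by rewrite modnn.
elim: n => [|n IH]; first by rewrite /residue !big_ord0.
rewrite !residueS expnS -IH {2}/digit /=; have := ltn_ord (digit x n).
by case: (nat_of_ord _) => [|[|[|]]]//= _; lia.
Qed.

HB.instance Definition _ :=
  GRing.isZmodule.Build Z3 addZ3A addZ3C add0Z3 addNZ3.

Definition haar_probability (R : realType) (lambda : probability Z3 R) : Prop :=
  forall (g : Z3) (A : set Z3), measurable A ->
    lambda [set x + g | x in A] = lambda A.

Definition cyl (n a : nat) : set Z3 := [set x | residue n x = a].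

Lemma residue_le (n m : nat) x y : (n <= m)%N -> residue m x = residue m y -> residue n x = residue n y.
Proof.
move=> nm /residueP h; apply/residueP => k kn; apply: h.
exact: leq_trans kn nm.
Qed.

Lemma nbhs_cyl (x : Z3) (U : set Z3) : nbhs x U -> exists n, cyl n (residue n x) `<=` U.
Proof.
pose F := filter_from [set: nat] (fun n => cyl n (residue n x)).
have FF : Filter F.
  apply: filter_from_filter; first by exists 0%N.
  move=> i j _ _; exists (maxn i j) => // y h.
  by split; apply: residue_le h; rewrite (leq_maxl, leq_maxr).
move=> [] P [] [] Q QfinP <- [] V JV Vpz PU.
suff : F U by case=> n _ h; exists n.
apply: (@filterS _ F _ V); first by move=> y Vy; apply: PU; exists V.
have [L Lsub /[dup] VL <-] := QfinP _ JV.
apply: filter_bigI => /= M /[dup] LM /Lsub /set_mem [] k _ [W oW WM].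
rewrite -WM.
have Wx : W (x k).
  by move: Vpz; rewrite -VL => /(_ _ LM); rewrite -WM.
exists k.+1 => // y /residueP /(_ k (ltnSn k)).
by rewrite /digit /= => ->.
Qed.

Lemma cyl_open n a : open (cyl n a).
Proof.
rewrite (_ : cyl n a = \bigcup_(x in cyl n a) \bigcap_(k in `I_n) [set y : Z3 | digit y k = digit x k]).
  apply: bigcup_open => x _; rewrite bigcap_mkord.
  apply: big_ind => [||k _]; [exact: openT|exact: openI|].
  have c : continuous (fun y : Z3 => y k : discrete_topology 'I_3).
    exact: (@proj_continuous nat (fun=> discrete_topology 'I_3) k).
  apply: (@open_comp _ _ (fun y : Z3 => y k : discrete_topology 'I_3) [set digit x k]) => [y _|]; first exact: c.
  exact: discrete_open.
apply/seteqP; split=> x; first by move=> xa; exists x.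
by move=> [y <-] xy; apply/residueP => k; exact: xy.
Qed.

Definition cyls : set (set Z3) := [set A | exists n a, A = cyl n a].

Lemma cyl_gt n a : (3 ^ n <= a)%N -> cyl n a = set0.
Proof.
by move=> na; apply/seteqP; split=> // x xa; move: (residue_lt n x); rewrite xa ltnNge na.
Qed.

Lemma cylsI : setI_closed cyls.
Proof.
suff h n m a b : (n <= m)%N -> cyls (cyl n a `&` cyl m b).
  move=> _ _ [n [a ->]] [m [b ->]]; have [/h//|/ltnW/h] := leqP n m.
  by rewrite setIC.
move=> nm; have [[z [za zb]]|no] := pselect (exists z, cyl n a z /\ cyl m b z).
  exists m, b; apply/seteqP; split=> [x []//|x xb]; split=> //.
  rewrite -za; apply: residue_le nm _; exact: etrans xb (esym zb).
exists 0%N, 1%N; rewrite (@cyl_gt 0 1)//; apply/seteqP; split=> // x h; apply: no.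
by exists x.
Qed.

Lemma measurable_cyls : @measurable _ Z3 = <<s cyls >>.
Proof.
apply/seteqP; split; last first.
  apply: smallest_sub; first exact: sigma_algebra_measurable.
  by move=> _ [n [a ->]]; apply: sub_sigma_algebra; exact: cyl_open.
apply: smallest_sub; first exact: smallest_sigma_algebra.
move=> U oU; rewrite (_ : U = \bigcup_(p in [set p : nat * nat | cyl p.1 p.2 `<=` U]) cyl p.1 p.2).
  rewrite bigcup_mkcond.
  apply: (@countable_bigcupT_measurable _ (g_sigma_algebraType cyls)) => //.
  move=> p; case: ifP => _; last exact: (@measurable0 _ (g_sigma_algebraType cyls)).
  by apply: sub_sigma_algebra; exists p.1, p.2.
apply/seteqP; split=> [x Ux|x [p /= h]]; last exact: h.
have [|n h] := @nbhs_cyl x U; first exact: open_nbhs_nbhs.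
by exists (n, residue n x).
Qed.

Lemma Z3_measure_unique (R : realType) (m1 m2 : {measure set Z3 -> \bar R}) :
  (forall n a, (a < 3 ^ n)%N -> m1 (cyl n a) = m2 (cyl n a)) -> (m1 setT < +oo)%E ->
  forall A, measurable A -> m1 A = m2 A.
Proof.
have cT : cyl 0 0 = setT by apply/seteqP; split=> // x _; rewrite /cyl /= /residue big_ord0.
move=> h m1oo; apply: (measure_unique cyls (fun=> setT)).
- exact: measurable_cyls.
- exact: cylsI.
- by exists 0%N, 0%N.
- by rewrite bigcup_const.
- move=> _ [n [a ->]]; have [|na] := ltnP a (3 ^ n)%N; first exact: h.
  by rewrite cyl_gt// !measure0.
- by move=> _.
Qed.

Lemma residue_addr n x g : residue n (x + g) = ((residue n x + residue n g) %% 3 ^ n)%N.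
Proof. exact: residue_add. Qed.

Lemma addr_preimage_cyl n a g : (a < 3 ^ n)%N ->
  [set x | cyl n a (x + g)] = cyl n ((a + (3 ^ n - residue n g)) %% 3 ^ n)%N.
Proof.
move=> an; have gn := residue_lt n g.
apply/seteqP; split=> x; rewrite /cyl/= residue_addr.
  move=> <-; rewrite modnDml -addnA subnKC; last exact: ltnW.
  by rewrite modnDr modn_small ?residue_lt.
move=> ->; rewrite modnDml -addnA subnK; last exact: ltnW.
by rewrite modnDr modn_small.
Qed.

Lemma measurable_cyl n a : measurable (cyl n a).
Proof. by apply: sub_sigma_algebra; exact: cyl_open. Qed.

Lemma measurable_addr g : measurable_fun setT (fun x : Z3 => x + g).
Proof.
apply: (measurability cyls); first by rewrite measurable_cyls.
move=> _ [_ [n [a ->]] <-]; rewrite setTI.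
have [an|na] := ltnP a (3 ^ n)%N; last by rewrite cyl_gt// preimage_set0.
have /= := addr_preimage_cyl g an; rewrite /preimage => ->.
exact: measurable_cyl.
Qed.

Lemma haar_of_cyl (R : realType) (lambda : probability Z3 R) :
  (forall n a, (a < 3 ^ n)%N -> lambda (cyl n a) = (3 ^- n)%:E) -> haar_probability lambda.
Proof.
move=> h g A mA.
rewrite (_ : [set x + g | x in A] = (fun x => x + - g) @^-1` A).
  pose mg : measurable_fun _ _ := measurable_addr (- g).
  apply: (Z3_measure_unique (m1 := pushforward lambda (fun x => x + - g)) (m2 := lambda)) => //.
  - move=> n a an; rewrite /= /pushforward /preimage addr_preimage_cyl// !h//.
    by rewrite ltn_pmod// expn_gt0.
  - by rewrite /= /pushforward preimage_setT probability_setT ltry.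
apply/seteqP; split=> [_ [x Ax <-]|x Ax] /=; first by rewrite addrK.
by exists (x - g) => //; rewrite subrK.
Qed.

Section existence.
Variable R : realType.

(* [haar_probability] is inhabited: the law of the base-3 digits of a uniform
   point of [0, 1[ is translation invariant. *)
Definition ternary (t : R) : Z3 := fun k =>
  if 0 <= t < 1 then inZp (Num.truncn (t * 3 ^+ k.+1)) : 'I_3 else ord0.

(* The first n digits read most significant first, as in a base-3 expansion
   of a real number ([residue] reads them least significant first). *)
Fixpoint horner3 (n : nat) (x : Z3) : nat :=
  if n is n'.+1 then (horner3 n' x * 3 + digit x n')%N else 0%N.

Lemma horner3_lt n x : (horner3 n x < 3 ^ n)%N.
Proof.
elim: n => //= n IH; rewrite expnS; have := ltn_ord (digit x n); lia.
Qed.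

Lemma truncn_mul3 (t : R) : 0 <= t -> (Num.truncn (t * 3) %/ 3)%N = Num.truncn t.
Proof.
move=> t0; apply/esym/eqP; rewrite truncn_eq//.
have t3 : 0 <= t * 3 by rewrite mulr_ge0.
have := truncn_itv t3; set m := Num.truncn (t * 3).
have := divn_eq m 3; have : (m %% 3 < 3)%N by rewrite ltn_pmod.
move: (m %/ 3)%N (m %% 3)%N => q r r3 ->.
have : (r%:R : R) < 3 by rewrite ltr_nat.
have : (r%:R : R) <= 2 by rewrite ler_nat.
have : (0 : R) <= r%:R by rewrite ler0n.
rewrite -!natr1 natrD natrM => ? ? ? /andP[? ?].
by apply/andP; split; lra.
Qed.

Lemma ternary_horner3 n x (t : R) : 0 <= t < 1 ->
  residue n (ternary t) = residue n x <-> Num.truncn (t * 3 ^+ n) = horner3 n x.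
Proof.
move=> t01; have /andP[t0 t1] := t01.
rewrite residueP; elim: n => [|n IH] /=.
  split=> // _; apply/eqP.
  by rewrite expr0 mulr1 truncn_eq// t0.
have t3 : 0 <= t * 3 ^+ n by rewrite mulr_ge0// exprn_ge0.
have e : (digit (ternary t) n = Num.truncn (t * 3 ^+ n.+1) %% 3 :> nat)%N.
  by rewrite /digit /ternary t01.
have q : (Num.truncn (t * 3 ^+ n.+1) %/ 3)%N = Num.truncn (t * 3 ^+ n).
  by rewrite exprSr mulrA truncn_mul3.
split=> h.
  rewrite (divn_eq (Num.truncn (t * 3 ^+ n.+1)) 3) q -e h//.
  by rewrite IH.1// => k kn; apply: h; exact: ltnW.
move: q e; rewrite h divnMDl// modnMDl divn_small// addn0 modn_small// => q e.
move=> k; rewrite ltnS leq_eqVlt => /predU1P[->|]; first exact: val_inj.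
by apply: IH.2.
Qed.

Definition of_nat (a : nat) : Z3 := oneZ3 *+ a.

Lemma residue_of_nat n a : (a < 3 ^ n)%N -> residue n (of_nat a) = a.
Proof.
rewrite /of_nat; elim: a => [|a IH] an; first by rewrite mulr0n; exact: residue0.
rewrite mulrSr residue_addr IH; last exact: ltnW.
by rewrite residue1 modnDmr addn1 modn_small.
Qed.

Lemma ternary_cyl n a : (a < 3 ^ n)%N ->
  ternary @^-1` cyl n a `&` `[0, 1[ =
  `[(horner3 n (of_nat a))%:R / 3 ^+ n, (horner3 n (of_nat a)).+1%:R / 3 ^+ n[%classic.
Proof.
move=> an; have hl := horner3_lt n (of_nat a).
have p : (0 : R) < 3 ^+ n by rewrite exprn_gt0.
apply/seteqP; split=> t /=.
  rewrite !in_itv/= => -[+ t01].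
  rewrite /cyl /= -{1}(residue_of_nat an) => /(ternary_horner3 _ _ t01).
  have t3 : 0 <= t * 3 ^+ n by have /andP[t0 _] := t01; rewrite mulr_ge0// ltW.
  by move=> <-; rewrite ler_pdivrMr// ltr_pdivlMr//; exact: truncn_itv.
rewrite !in_itv/= ler_pdivrMr// ltr_pdivlMr// => tn.
have t0 : 0 <= t.
  have /andP[h _] := tn; rewrite -(pmulr_lge0 _ p); exact: le_trans h.
have t1 : t < 1.
  have /andP[_ h] := tn; rewrite -(ltr_pM2r p) mul1r; apply: lt_le_trans h _.
  by rewrite -natrX ler_nat.
have t01 : 0 <= t < 1 by rewrite t0 t1.
split=> //; rewrite /cyl/= -[RHS](residue_of_nat an); apply/ternary_horner3 => //.
by apply/eqP; rewrite truncn_eq// mulr_ge0// ltW.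
Qed.

Lemma measurable_ternary : measurable_fun setT ternary.
Proof.
apply: (measurability cyls); first by rewrite measurable_cyls.
move=> _ [_ [n [a ->]] <-]; rewrite setTI.
have [an|na] := ltnP a (3 ^ n)%N; last by rewrite cyl_gt// preimage_set0.
rewrite -[X in measurable X](setUIDK _ `[0, 1[) ternary_cyl//.
apply: measurableU => //.
have [->|a0] := eqVneq a 0%N.
  rewrite (_ : _ `\` _ = ~` `[0, 1[); first exact: measurableC.
  apply/seteqP; split=> t; first by case.
  rewrite /= in_itv/= => /negP/negbTE t01.
  by split; [rewrite /cyl/= /residue big1// => k _; rewrite /digit/ternary t01|rewrite t01].
rewrite (_ : _ `\` _ = set0)//; apply/seteqP; split=> t // -[].
rewrite /cyl/= in_itv/= => ta /negP/negbTE t01; move/eqP: a0; apply.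
by rewrite -ta /residue big1// => k _; rewrite /digit/ternary t01.
Qed.


Let mI : measurable (`[0, 1[ : set R). Proof. by []. Qed.

Definition ternary_law (A : set Z3) : \bar R :=
  mrestr (@lebesgue_measure R) mI (ternary @^-1` A).

Let mpre A : measurable A -> measurable (ternary @^-1` A).
Proof. by move=> mA; rewrite -[X in measurable X]setTI; exact: measurable_ternary. Qed.

Let law0 : ternary_law set0 = 0%E.
Proof. by rewrite /ternary_law preimage_set0 measure0. Qed.

Let law_ge0 A : (0 <= ternary_law A)%E.
Proof. exact: measure_ge0. Qed.

Let law_sigma_additive : semi_sigma_additive ternary_law.
Proof.
move=> F mF tF mUF; rewrite /ternary_law preimage_bigcup.
apply: measure_semi_sigma_additive.
- by move=> n; exact: mpre.
- apply/trivIsetP => /= i j _ _ ij; rewrite -preimage_setI.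
  by move/trivIsetP : tF => /(_ _ _ _ _ ij) ->//; rewrite preimage_set0.
- by rewrite -preimage_bigcup; exact: mpre.
Qed.

HB.instance Definition _ := isMeasure.Build _ _ _ ternary_law
  law0 law_ge0 law_sigma_additive.

Let law_setT : ternary_law [set: _] = 1%E.
Proof.
rewrite /ternary_law /mrestr preimage_setT setTI lebesgue_measure_itv/= lte_fin ltr01.
by rewrite -EFinB subr0.
Qed.

HB.instance Definition _ := Measure_isProbability.Build _ _ _ ternary_law law_setT.

Lemma haar_exists : exists lambda : probability Z3 R, haar_probability lambda.
Proof.
exists ternary_law; apply: haar_of_cyl => n a an.
have p : (0 : R) < 3 ^+ n by rewrite exprn_gt0.
rewrite /= /ternary_law /mrestr ternary_cyl// lebesgue_measure_itv/= lte_fin.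
rewrite ltr_pM2r ?invr_gt0// ltr_nat leqnn -EFinB -mulrBl -natr1.
by rewrite addrAC subrr add0r mul1r.
Qed.
End existence.

Definition succZ3 (x : Z3) : Z3 := x + oneZ3.

(* The value at (2, 2, ...), where phi is undefined, is set to 0. *)
Definition phi (x : Z3) : nat :=
  if pselect (exists k, digit x k != 2 :> nat) is left h
  then digit x (ex_minn h) else 0%N.

Definition phi_sum (m : nat) (x : Z3) : nat := (\sum_(i < m) phi (iter i succZ3 x))%N.

Definition pi_ (R : realType) (lambda : probability Z3 R) (m : nat) (j : int) : R :=
  fine (lambda [set x | (phi_sum m x)%:Z = j]).

Definition P_ (R : realType) (lambda : probability Z3 R) (m : nat) : {poly R} :=
  \poly_(j < m.+1) pi_ lambda m j%:Z.

(* Main.v *)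
Require Import Defs.
From mathcomp Require Import all_boot all_order all_algebra.
From mathcomp Require Import all_classical all_reals all_analysis.
From mathcomp Require Import zify ring.

Import Order.TTheory GRing.Theory Num.Theory.
Local Open Scope ring_scope.

(** The Haar measure splits along the first digit.  Write [x = d + 3y] with
    [d] the first digit of [x] and [y] the [shift] of [x].  Then

    - [d] is uniform, [y] is again Haar distributed, and they are independent
      ([haar_shift]).  Both sides are finite measures, so it suffices to
      compare them on cylinders; there, invariance under translations and
      total mass 1 force every residue class modulo [3 ^ n] to have mass
      [3 ^- n] ([haar_cyl]);
    - [phi x] is [d] if [d] is not 2, and [phi y] otherwise ([phi_rec]);
      adding 1 to [x] changes [y] only when [d = 2], and then adds 1 to it
      ([shift_succ]).

    Hence three successive points of the orbit of [x] have the first digits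
    0, 1, 2 in some cyclic order.  The digits 0 and 1 contribute 0 + 1 to the
    sum of [phi], and the digit 2 contributes one term of the orbit sum of [y].
    So [phi_sum (3 * m) x] is [m + phi_sum m y] whatever [d] is
    ([phi_sum_mul3]), and the one or two extra terms of the other two cases
    depend on [d] in an explicit way ([phi_sum_mul3_1], [phi_sum_mul3_2]).

    All three formulas have the shape [phi_sum M x = c d + phi_sum (k d) y].
    Conditioning on [d] turns such a formula into
    [P_M = 1/3 * sum over d of X^(c d) P_(k d)] ([P_digit]), which gives the
    three identities. *)

(** * Splitting off the first digit *)

Definition shift (x : Z3) : Z3 := fun k => digit x k.+1.

Lemma digit_shift x k : digit (shift x) k = digit x k.+1.
Proof. by []. Qed.

Lemma digit_cases x k :
  [\/ digit x k = 0%N :> nat, digit x k = 1%N :> nat | digit x k = 2%N :> nat].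
Proof.
by case: (digit x k) => -[|[|[|]]] //= _; [constructor 1|constructor 2|constructor 3].
Qed.

Lemma residueS_shift n x : residue n.+1 x = (digit x 0 + 3 * residue n (shift x))%N.
Proof.
rewrite /residue big_ord_recl expn0 muln1; congr addn.
by rewrite big_distrr; apply: eq_bigr => k _; rewrite digit_shift expnS mulnCA.
Qed.

Lemma residue1_digit x : residue 1 x = digit x 0.
Proof. by rewrite residueS_shift /residue big_ord0 muln0 addn0. Qed.

(** * The successor map and phi through the first digit *)

Lemma digit0_succ x : digit (succZ3 x) 0 = ((digit x 0 + 1) %% 3)%N :> nat.
Proof. by rewrite {1}/digit /= addn0. Qed.

(** A carry leaves the first digit exactly when that digit is 2.  In that case
    it acts on the shift as the summand [oneZ3], whose only nonzero digit is
    the first one; hence the term [digit oneZ3 k]. *)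
Lemma carry_succ x k : carry x oneZ3 k.+1 =
  if digit x 0 == 2%N :> nat then (digit oneZ3 k + carry (shift x) oneZ3 k)%N else 0%N.
Proof.
have carryS y j : carry y oneZ3 j.+1 =
  ((digit y j + digit oneZ3 j + carry y oneZ3 j) %/ 3)%N by [].
have carry0 y : carry y oneZ3 0 = 0%N by [].
have one0 : digit oneZ3 0 = 1%N :> nat by [].
have oneS j : digit oneZ3 j.+1 = 0%N :> nat by [].
elim: k => [|k IH]; rewrite carryS.
  by rewrite one0 !carry0; have := ltn_ord (digit x 0); case: eqP; lia.
rewrite IH oneS; case: ifP => _; first by rewrite carryS digit_shift addn0 add0n addnA.
by rewrite !addn0 divn_small.
Qed.

Lemma shift_succ x : shift (succZ3 x) =
  if digit x 0 == 2%N :> nat then succZ3 (shift x) else shift x.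
Proof.
apply/funext => k; have c := carry_succ x k.
rewrite [LHS](_ : _ = inZp (digit x k.+1 + carry x oneZ3 k.+1) :> 'I_3); last first.
  by apply: val_inj; rewrite /= addn0.
rewrite c; case: ifP => _; first by apply: val_inj; rewrite /= addnA.
by apply: val_inj; rewrite /= addn0 modn_small.
Qed.

Lemma phi_first_digit x k : digit x k <> 2%N :> nat ->
  (forall i, (i < k)%N -> digit x i = 2%N :> nat) -> phi x = digit x k.
Proof.
move=> /eqP xk x2; rewrite /phi; case: pselect => [h|[]]; last by exists k.
case: ex_minnP => j xj jmin; suff -> : j = k by [].
apply/eqP; rewrite eqn_leq jmin//= leqNgt; apply/negP => /x2 e.
by rewrite e in xj.
Qed.

(** A first digit 2 is skipped by [phi], so the search resumes in the shift.
    The value 0 chosen for [phi] at (2, 2, ...), a point fixed by the shift,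
    makes the recursion hold everywhere and not only almost everywhere. *)
Lemma phi_rec x : phi x = if digit x 0 == 2%N :> nat then phi (shift x) else digit x 0.
Proof.
case: eqP => [x0|x0]; last exact: phi_first_digit.
have [h|no] := pselect (exists k, digit (shift x) k != 2%N :> nat); last first.
  rewrite /phi; case: pselect => [h|_]; last by case: pselect.
  exfalso; have [[|k] xk] := h; first by rewrite x0 in xk.
  by apply: no; exists k.
have [k /eqP xk kmin] := ex_minnP h.
have x2 i : (i < k)%N -> digit (shift x) i = 2%N :> nat.
  by move=> ik; apply: contraTeq ik => /kmin; rewrite -leqNgt.
rewrite (@phi_first_digit (shift x) k)// (@phi_first_digit x k.+1)//.
by case.
Qed.

(** An explicit form of the event [phi = 1], from which its measurability can
    be read off: it is a countable union of cylinders. *)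
Lemma phi_eq1 x : phi x = 1%N <->
  exists k, digit x k = 1%N :> nat /\ forall i, (i < k)%N -> digit x i = 2%N :> nat.
Proof.
split=> [|[k [xk x2]]]; last by rewrite (@phi_first_digit x k) ?xk.
rewrite /phi; case: pselect => // h; case: ex_minnP => k _ kmin xk.
exists k; split=> // i ik; apply/eqP; apply/negPn/negP => /kmin.
by rewrite leqNgt ik.
Qed.

Lemma phi_le1 x : (phi x <= 1)%N.
Proof.
rewrite /phi; case: pselect => // h; case: ex_minnP => k /eqP xk _.
by have := ltn_ord (digit x k); lia.
Qed.

(** * Orbit sums of phi *)

Lemma phi_sum_le m x : (phi_sum m x <= m)%N.
Proof.
rewrite -[leqRHS]muln1 -[m in leqRHS]card_ord -sum_nat_const.
by apply: leq_sum => i _; exact: phi_le1.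
Qed.

Lemma phi_sumS m x : phi_sum m.+1 x = (phi x + phi_sum m (succZ3 x))%N.
Proof.
rewrite /phi_sum big_ord_recl; congr addn; apply: eq_bigr => i _.
by rewrite -iterSr.
Qed.

Lemma phi_sumSr m x : phi_sum m.+1 x = (phi_sum m x + phi (iter m succZ3 x))%N.
Proof. by rewrite /phi_sum big_ord_recr. Qed.

Lemma phi_sumD m n x : phi_sum (m + n) x = (phi_sum m x + phi_sum n (iter m succZ3 x))%N.
Proof.
rewrite /phi_sum big_split_ord; congr addn; apply: eq_bigr => i _ /=.
by rewrite addnC iterD.
Qed.

(** Along three steps the first digit runs through 0, 1, 2 in cyclic order and
    returns to its start, and exactly one carry reaches the shift.  The digits
    0 and 1 contribute 0 + 1.  The digit 2 contributes [phi] of the shift,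
    which has not moved yet because the carry occurs when leaving the digit 2. *)
Lemma succ3 x :
  [/\ digit (iter 3 succZ3 x) 0 = digit x 0,
      shift (iter 3 succZ3 x) = succZ3 (shift x) &
      phi_sum 3 x = (phi (shift x)).+1].
Proof.
have d1 := digit0_succ x; have d2 := digit0_succ (succZ3 x).
have d3 := digit0_succ (succZ3 (succZ3 x)).
have s1 := shift_succ x; have s2 := shift_succ (succZ3 x).
have s3 := shift_succ (succZ3 (succZ3 x)).
have p : phi_sum 3 x = (phi x + phi (succZ3 x) + phi (succZ3 (succZ3 x)))%N.
  by rewrite !phi_sumSr /phi_sum big_ord0.
have p1 := phi_rec x; have p2 := phi_rec (succZ3 x).
have p3 := phi_rec (succZ3 (succZ3 x)).
have [e|e|e] := digit_cases x 0.
all: rewrite e in d1 s1 p1; rewrite d1 in d2 s2 p2;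
  rewrite d2 in d3 s3 p3.
all: rewrite p p1 p2 p3 [iter _ _ _]/= s3 ?s2 ?s1; split=> //; try by rewrite /=; lia.
all: by apply: ord_inj; rewrite d3 e.
Qed.

Lemma phi_sum_mul3 m x :
  [/\ digit (iter (3 * m) succZ3 x) 0 = digit x 0,
      shift (iter (3 * m) succZ3 x) = iter m succZ3 (shift x) &
      phi_sum (3 * m) x = (m + phi_sum m (shift x))%N].
Proof.
elim: m => [|m [d s p]]; first by rewrite muln0 /phi_sum !big_ord0.
have [d3 s3 p3] := succ3 (iter (3 * m) succZ3 x).
rewrite mulnS iterD d3 d s3 s addnC phi_sumD p p3 s phi_sumSr; split=> //; lia.
Qed.

Lemma phi_sum_mul3_1 m x : phi_sum (3 * m + 1) x =
  (m + if digit x 0 == 2%N :> nat then phi_sum (m + 1) (shift x)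
       else digit x 0 + phi_sum m (shift x))%N.
Proof.
have [d s p] := phi_sum_mul3 m x.
rewrite !addn1 !phi_sumSr p (phi_rec (iter (3 * m) succZ3 x)) d s.
by case: ifP => _; lia.
Qed.

(** The last two points of the orbit have first digits [d] and [d + 1] modulo 3.
    For [d = 1] and [d = 2] one of them is 2 and adds a term to the orbit sum of
    the shift; for [d = 0] they contribute 0 + 1. *)
Lemma phi_sum_mul3_2 m x : phi_sum (3 * m + 2) x =
  (m + if digit x 0 == 0%N :> nat then 1 + phi_sum m (shift x)
       else if digit x 0 == 1%N :> nat then 1 + phi_sum (m + 1) (shift x)
       else phi_sum (m + 1) (shift x))%N.
Proof.
have [d s p] := phi_sum_mul3 m x.
rewrite (addnS (3 * m) 1) phi_sumSr phi_sum_mul3_1 [(3 * m + 1)%N]addn1 iterS phi_rec digit0_succ.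
rewrite shift_succ d s addn1 !phi_sumSr.
have [e|e|e] := digit_cases x 0.
all: by rewrite e /=; lia.
Qed.

(** * Measurability *)

Local Open Scope classical_set_scope.

(** Finitely many digits take finitely many values, so an event depending only
    on them is a finite union of cylinders. *)
Lemma measurable_residue_saturated n (A : set Z3) :
  (forall x y, residue n x = residue n y -> A x -> A y) -> measurable A.
Proof.
move=> sat; rewrite (_ : A = \bigcup_(a in residue n @` A) cyl n a).
  by apply: bigcup_measurable => a _; exact: measurable_cyl.
apply/seteqP; split=> [x Ax|x [_ [y Ay <-]] xy]; first by exists (residue n x) => //; exists x.
exact: sat (esym xy) Ay.
Qed.

Lemma measurable_shift : measurable_fun [set: Z3] shift.
Proof.
apply: (measurability cyls); first by rewrite measurable_cyls.
move=> _ [_ [n [a ->]] <-]; rewrite setTI.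
apply: (@measurable_residue_saturated n.+1) => x y.
move=> /residueP xy; rewrite /cyl /preimage /= => <-; apply/residueP => k kn.
by rewrite !digit_shift xy.
Qed.

Lemma measurable_succ : measurable_fun [set: Z3] succZ3.
Proof. exact: measurable_addr. Qed.

Lemma measurable_phi : measurable_fun [set: Z3] phi.
Proof.
have -> : phi = nat_of_bool \o (fun x => phi x == 1%N).
  by apply/funext => x /=; have := phi_le1 x; case: (phi x) => [|[|]].
apply: measurableT_comp => //; apply: (measurable_fun_bool true).
rewrite setTI (_ : _ @^-1` _ = \bigcup_k [set x | digit x k = 1%N :> nat /\
    forall i, (i < k)%N -> digit x i = 2%N :> nat]).
  apply: bigcupT_measurable => k; apply: (@measurable_residue_saturated k.+1) => x y.
  move=> /residueP xy [xk x2]; split=> [|i ik]; first by rewrite -xy.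
  by rewrite -xy ?x2// (leqW ik).
apply/seteqP; split=> x /=.
  by move=> /eqP/phi_eq1[k xk]; exists k.
by move=> [k _ xk]; apply/eqP/phi_eq1; exists k.
Qed.

Lemma measurable_phi_sum m : measurable_fun [set: Z3] (phi_sum m).
Proof.
elim: m => [|m IH].
  by rewrite (_ : phi_sum 0 = cst 0%N)//; apply/funext => x; rewrite /phi_sum big_ord0.
rewrite (_ : phi_sum m.+1 = fun x => (phi x + phi_sum m (succZ3 x))%N); last first.
  by apply/funext => x; exact: phi_sumS.
apply: measurable_realfun.measurable_fun_addn; first exact: measurable_phi.
by apply: measurableT_comp => //; exact: measurable_succ.
Qed.

Lemma measurable_phi_sum_level m (j : int) : measurable [set x | (phi_sum m x)%:Z = j].
Proof.
rewrite (_ : [set x | _] = phi_sum m @^-1` [set n | n%:Z = j])//.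
by rewrite -[X in measurable X]setTI; apply: measurable_phi_sum.
Qed.

(** * The first digit under the Haar measure *)

Section haar.
Variables (R : realType) (lambda : probability Z3 R).
Hypothesis lambda_haar : haar_probability lambda.

Lemma bigcup_cyl n : \big[setU/set0]_(a < 3 ^ n) cyl n a = [set: Z3].
Proof.
rewrite -(bigcup_mkord _ (fun a => cyl n a)); apply/seteqP; split=> // x _.
by exists (residue n x) => //=; exact: residue_lt.
Qed.

Lemma trivIset_cyl n : trivIset setT (cyl n).
Proof.
apply/trivIsetP => a b _ _ /eqP ab; apply/seteqP; split=> // x [xa xb].
by apply: ab; exact: etrans (esym xa) xb.
Qed.

(** The [3 ^ n] residue classes are translates of each other and cover the
    space, so they share the mass 1 equally. *)
Lemma haar_cyl n a : (a < 3 ^ n)%N -> lambda (cyl n a) = (3 ^- n)%:E.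
Proof.
have eq0 b : (b < 3 ^ n)%N -> lambda (cyl n b) = lambda (cyl n 0).
  move=> bn; rewrite -(lambda_haar (of_nat b) _ (measurable_cyl n 0)); congr (lambda _).
  apply/seteqP; split=> [x xb|_ [x x0 <-]]; last first.
    by rewrite /cyl /= residue_addr x0 residue_of_nat ?modn_small.
  exists (x - of_nat b); last by rewrite subrK.
  have := residue_addr n (x - of_nat b) (of_nat b).
  rewrite subrK (residue_of_nat bn) xb /cyl /=.
  have := residue_lt n (x - of_nat b); set r := residue _ _ => rn e.
  have /eqP : (0 + b = r + b %[mod 3 ^ n])%N by rewrite -e add0n modn_small.
  by rewrite eqn_modDr mod0n modn_small// => /eqP.
have := probability_setT lambda; rewrite -(bigcup_cyl n).
rewrite (measure_bigsetU _ (measurable_cyl n) (trivIset_cyl n)) => tot an.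
rewrite eq0//; move: tot; rewrite (eq_bigr (fun=> lambda (cyl n 0))); last first.
  by move=> b _; exact: eq0.
have : lambda (cyl n 0) \is a fin_num by apply: fin_num_measure; exact: measurable_cyl.
case: (lambda (cyl n 0)) => // r _; rewrite sumEFin => -[].
rewrite sumr_const card_ord -(mulr_natl r) natrX => e; congr EFin.
have p : (3 ^+ n : R) != 0 by rewrite expf_neq0.
by rewrite -[LHS](mulKf p) e mulr1.
Qed.

(** The first digit is uniform and independent of the shift, which is again
    Haar distributed: on cylinders this reads
    [3 ^- n.+1 = 3^-1 * 3 ^- n], because the points with first digit [d] whose
    shift is [a] modulo [3 ^ n] form the class of [d + 3 * a] modulo
    [3 ^ n.+1]. *)
Lemma haar_shift d A : (d < 3)%N -> measurable A ->
  lambda (shift @^-1` A `&` cyl 1 d) = (3^-1%:E * lambda A)%E.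
Proof.
move=> d3.
(* [mshift] lets the pushforward be recognised as a measure. *)
pose mshift : measurable_fun _ _ := measurable_shift.
have i3 : 0 <= 3^-1 :> R by rewrite invr_ge0.
pose m1 := pushforward (mrestr lambda (measurable_cyl 1 d)) shift.
pose m2 := mscale (NngNum i3) lambda.
move=> mA; apply: (Z3_measure_unique (m1 := m1) (m2 := m2)) => //=.
  move=> n a an; rewrite /m1 /m2 /pushforward /mrestr /mscale /=.
  rewrite haar_cyl// (_ : _ `&` cyl 1 d = cyl n.+1 (d + 3 * a)%N); last first.
    apply/seteqP; split=> x; rewrite /cyl /preimage /= residue1_digit residueS_shift.
      by move=> [<- <-].
    have := ltn_ord (digit x 0) => ? e; split; lia.
  by rewrite haar_cyl; [rewrite -EFinM exprS invfM|rewrite expnS; lia].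
by rewrite /m1 /pushforward /mrestr preimage_setT setTI haar_cyl// ltry.
Qed.

(** * From orbit sums to generating polynomials *)

(** The law of total probability, conditioning on the first digit. *)
Lemma pi_digit (M : nat) (c k : nat -> nat) (j : int) :
  (forall x, phi_sum M x = c (digit x 0) + phi_sum (k (digit x 0)) (shift x))%N ->
  pi_ lambda M j = 3^-1 * \sum_(d < 3) pi_ lambda (k d) (j - (c d)%:Z).
Proof.
move=> Mck.
pose F n := [set x | (phi_sum (k n) x)%:Z = j - (c n)%:Z].
have mF n : measurable (F n) by exact: measurable_phi_sum_level.
pose G n := shift @^-1` F n `&` cyl 1 n.
have mG n : measurable (G n).
  apply: measurableI; last exact: measurable_cyl.
  by rewrite -[X in measurable X]setTI; exact: measurable_shift.
have -> : pi_ lambda M j = fine (lambda (\big[setU/set0]_(d < 3) G d)).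
  congr (fine (lambda _)); rewrite -(bigcup_mkord _ G); apply/seteqP.
  split=> [x|x [n _ [/= xF]]]; rewrite /= /cyl /= ?residue1_digit Mck PoszD.
    move=> e; exists (digit x 0); first exact: ltn_ord.
    by split; [rewrite /preimage /F /= -e addrAC subrr add0r|rewrite /cyl/= residue1_digit].
  by move=> xn; rewrite xn xF addrCA subrr addr0.
rewrite measure_bigsetU//; last first.
  exact: trivIset_setIl (trivIset_cyl 1).
rewrite (eq_bigr (fun d : 'I_3 => (3^-1 * pi_ lambda (k d) (j - (c d)%:Z))%:E)).
  by rewrite sumEFin mulr_sumr.
move=> d _; apply: etrans (haar_shift _ _ (ltn_ord d) (mF d)) _; rewrite EFinM; congr (_ * _)%E.
by rewrite /pi_ fineK//; apply: fin_num_measure; exact: mF.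
Qed.

Lemma pi_eq0 m (j : int) : ~~ (0 <= j <= m%:Z) -> pi_ lambda m j = 0.
Proof.
move=> h; rewrite /pi_ (_ : [set x | _] = set0) ?measure0//.
apply/seteqP; split=> // x /= xj; move: h; rewrite -xj.
by have := phi_sum_le m x; lia.
Qed.

(** The truncation of [P_] at degree [m] loses nothing, since
    [phi_sum m] is at most [m]. *)
Lemma coef_P m i : (P_ lambda m)`_i = pi_ lambda m i.
Proof.
by rewrite coef_poly; case: ltnP => // mi; rewrite pi_eq0// lez_nat -ltnNge.
Qed.

(** With [pi_] indexed by integers, multiplication by ['X^n] is a plain
    translation of the index, with no case split at negative indices. *)
Lemma coef_XnP n m i : ('X^n * P_ lambda m)`_i = pi_ lambda m (i%:Z - n%:Z).
Proof.
rewrite coefXnM coef_P; case: ltnP => [i_n|ni]; last by rewrite subzn.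
by rewrite pi_eq0//; lia.
Qed.

Lemma P_digit (M : nat) (c k : nat -> nat) :
  (forall x, phi_sum M x = c (digit x 0) + phi_sum (k (digit x 0)) (shift x))%N ->
  P_ lambda M = 3^-1 *: \sum_(d < 3) 'X^(c d) * P_ lambda (k d).
Proof.
move=> Mck; apply/polyP => i; rewrite coefZ coef_sum.
under eq_bigr do rewrite coef_XnP.
by rewrite coef_P (pi_digit _ _ _ _ Mck).
Qed.

End haar.

Local Close Scope classical_set_scope.

Theorem theorem3p3 (R : realType) (lambda : probability Z3 R)
    (lambda_haar : haar_probability lambda) (m : nat) :
  [/\ P_ lambda (3 * m) = 'X^m * P_ lambda m,
      P_ lambda (3 * m + 1) =
        3^-1 *: ('X^m * ((1 + 'X) * P_ lambda m + P_ lambda (m + 1)))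
    & P_ lambda (3 * m + 2) =
        3^-1 *: ('X^m * ('X * P_ lambda m + (1 + 'X) * P_ lambda (m + 1)))].
Proof.
split.
- rewrite (P_digit _ _ lambda_haar _ (fun=> m) (fun=> m)); last first.
    by move=> x; have [_ _] := phi_sum_mul3 m x.
  rewrite sumr_const card_ord -(scaler_nat _ ('X^m * _)) scalerA mulVf ?scale1r//.
- rewrite (P_digit _ _ lambda_haar _ (fun d => if d == 2%N then m else m + d)%N
    (fun d => if d == 2%N then m + 1 else m)%N); last first.
    by move=> x; rewrite phi_sum_mul3_1; case: ifP => _; rewrite ?addnA.
  by rewrite !big_ord_recr big_ord0 /= add0r; congr (_ *: _); rewrite addn0 exprD expr1; ring.
- rewrite (P_digit _ _ lambda_haar _ (fun d => if d == 2%N then m else m + 1)%N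
    (fun d => if d == 0%N then m else m + 1)%N); last first.
    move=> x; rewrite phi_sum_mul3_2; have := ltn_ord (digit x 0).
    by case: (nat_of_ord (digit x 0)) => [|[|[|]]] //= _; rewrite ?addnA.
  by rewrite !big_ord_recr big_ord0 /= add0r; congr (_ *: _); rewrite exprD expr1; ring.
Qed.
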